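(* Let $(\mathbb X,\mathcal E)$ be a quasi-regular strongly local Dirichlet space, $\mathsf d\colon X\times X\to[0,\infty]$ an extended pseudo-distance, and $\mu$ a $\sigma$-finite Borel measure not charging $\mathcal E$-polar sets which is $\mathcal E$-moderate. Assume that: (a) $(\mathbb X,\mathcal E,\mathsf d,\mu)$ possesses the Rademacher property for the $\sigma$-algebra $\mathcal B_\tau^{\mathfrak m}$ and the Sobolev-to-Lipschitz property for the $\sigma$-algebra $\mathcal B_\tau^{\mathfrak m}$; (b) $\mathsf d(\cdot,A)$ is $\mathcal B_\tau^{\mathfrak m}$-measurable for every $A\in\Sigma$, and $\mathsf d$ is $\tau$-admissible. Then for each $A\in\Sigma$ there exists $\tilde A\in\Sigma$ with $\tilde A\subset A$, with $A\triangle\tilde A$ $\mathfrak m$-negligible, and $$\bar{\mathsf d}_{\mu,A}=\bar{\mathsf d}_{\mu,\tilde A}=\mathsf d(\cdot,\tilde A)=\mathsf d_\mu(\cdot,\tilde A)\qquad\mathfrak m\text{-a.e.}$$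
   Context: Setting. $\mathbb X=(X,\tau,\Sigma,\mathfrak m)$, where $(X,\tau)$ is a topological Luzin space (Hausdorff and a continuous injective image of a Polish space), $\mathcal B_\tau$ is its Borel $\sigma$-algebra, $\mathfrak m$ is a positive $\sigma$-finite measure with full $\tau$-support, and $\Sigma$ is a $\sigma$-algebra with $\mathcal B_\tau\subset\Sigma\subset\mathcal B_\tau^{\mathfrak m}$ (the $\mathfrak m$-completion). A Dirichlet space $(\mathbb X,\mathcal E)$ carries a symmetric Dirichlet form $(\mathcal E,\mathcal F)$ on $L^2(\mathfrak m)$ (densely defined, closed, Markovian); $\mathcal F$ has norm $(\mathcal E(f,f)+\|f\|_{L^2}^2)^{1/2}$, and $\mathcal F_b=\mathcal F\cap L^\infty(\mathfrak m)$. Quasi-notions. For Borel $A$, $\mathcal F_A=\{u\in\mathcal F: u=0\ \mathfrak m\text{-a.e. on }X\setminus A\}$. An $\mathcal E$-nest is an increasing sequence $(F_n)$ of $\tau$-closed sets with $\bigcup_n\mathcal F_{F_n}$ dense in $\mathcal F$. A set $N$ is $\mathcal E$-polar if $N\subset X\setminus\bigcup_nF_n$ for some $\mathcal E$-nest; $\mathcal E$-q.e. means outside an $\mathcal E$-polar set. $G$ is $\mathcal E$-quasi-open if for some $\mathcal E$-nest $(F_n)$ each $G\cap F_n$ is relatively open in $F_n$ (quasi-open sets are always taken Borel). A function is $\mathcal E$-quasi-continuous if its restriction to each $F_n$ is continuous for some $\mathcal E$-nest; $\widetilde f$ denotes an $\mathcal E$-quasi-continuous representative of $f$. $(\mathbb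 X,\mathcal E)$ is quasi-regular if: there is an $\mathcal E$-nest of compact sets; a dense subset of $\mathcal F$ has $\mathcal E$-quasi-continuous representatives; there are an $\mathcal E$-polar $N$ and countably many $u_n\in\mathcal F$ with $\mathcal E$-quasi-continuous representatives separating points of $X\setminus N$. It is strongly local if $\mathcal E(f,g)=0$ whenever $f,g\in\mathcal F$ have compact support and $f$ is constant on a neighborhood of $\operatorname{supp} g$. Broad local spaces. $\mathscr G$ is the set of sequences $G_\bullet=(G_n)$ of $\mathcal E$-quasi-open sets with $G_n\subset G_{n+1}$ $\mathcal E$-q.e. and $\bigcup_nG_n=X$ $\mathcal E$-q.e. For a family $\mathscr A$ of $\mathfrak m$-classes of functions, $\mathscr A^\bullet_{\mathrm{loc}}$ is the set of classes $f$ for which there are $G_\bullet\in\mathscr G$ and $f_n\in\mathscr A$ with $f=f_n$ $\mathfrak m$-a.e. on $G_n$ for all $n$. One has $\mathcal F^\bullet_{\mathrm{loc}}=(\mathcal F_b)^\bullet_{\mathrm{loc}}$. Energy measures. For $f\in\mathcal F_b$, $\mu_{\langle f\rangle}$ is the unique finite Borel measure not charging $\mathcal E$-polar sets with $\int\widetilde h\,d\mu_{\langle f\rangle}=2\mathcal E(fh,f)-\mathcal E(f^2,h)$ for all $h\in\mathcal F_b$ (so $\mathcal E(f,f)=\tfrac12\mu_{\langle f\rangle}(X)$). For $f\in\mathcal F^\bullet_{\mathrm{loc}}$, with $G_\bullet\in\mathscr G$ and $f_n\in\mathcal F_b$ such that $f=f_n$ $\mathfrak m$-a.e. on $G_n$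 for all $n$, $\mu_{\langle f\rangle}(B)=\lim_n\mu_{\langle f_n\rangle}(B\cap G_n)$, independently of the choices. A $\sigma$-finite Borel measure $\mu$ is $\mathcal E$-dominant if $\mu_{\langle f\rangle}\ll\mu$ for all $f\in\mathcal F$. Moderance. $\mathscr G_0$ is the set of $G_\bullet\in\mathscr G$ for which there are $e_n\in\mathcal F$ with $0\le e_n\le1$ and $e_n=1$ $\mathfrak m$-a.e. on $G_n$. A $\sigma$-finite Borel measure $\mu$ not charging $\mathcal E$-polar sets is $\mathcal E$-moderate if there are $G_\bullet\in\mathscr G_0$ and such $(e_n)$ with $\int\widetilde e_n\,d\mu<\infty$ for all $n$. Bounded energy and intrinsic distance. $\mathbb L^\mu_{\mathrm{loc}}=\{f\in\mathcal F^\bullet_{\mathrm{loc}}:\mu_{\langle f\rangle}\le\mu\}$; $\mathbb L^{\mu,\tau}_{\mathrm{loc},b}$ is the set of bounded $\tau$-continuous functions in $\mathbb L^\mu_{\mathrm{loc}}$; $\mathsf d_\mu(x,y)=\sup\{f(x)-f(y):f\in\mathbb L^{\mu,\tau}_{\mathrm{loc},b}\}$. Distances. An extended pseudo-distance $\mathsf d\colon X\times X\to[0,\infty]$ is symmetric, vanishes on the diagonal and satisfies the triangle inequality; a pseudo-distance is moreover finite. $\mathsf d(\cdot,A)=\inf_{y\in A}\mathsf d(\cdot,y)$ ($\inf\varnothing=+\infty$). A uniformity is a family of pseudo-distances closed under pairwise maxima and containing every pseudo-distance dominated by one of its members; $\mathsf d$ is $\tau$-admissible if $\mathsf d=\sup\{\mathsf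 d':\mathsf d'\in\mathscr U\}$ for some uniformity $\mathscr U$ of $\tau\times\tau$-continuous pseudo-distances. For a $\sigma$-algebra $\Sigma'$ on $X$, $\mathrm{Lip}^1(\mathsf d,\Sigma')$ is the set of $\Sigma'$-measurable $\hat f\colon X\to\mathbb R$ with $|\hat f(x)-\hat f(y)|\le\mathsf d(x,y)$ for all $x,y$. Rademacher property for $\Sigma'=\mathcal B_\tau^{\mathfrak m}$: every $\hat f\in\mathrm{Lip}^1(\mathsf d,\Sigma')$ whose $\mathfrak m$-class $f$ lies in $(L^\infty(\mathfrak m))^\bullet_{\mathrm{loc}}$ satisfies $f\in\mathbb L^\mu_{\mathrm{loc}}$. Sobolev-to-Lipschitz property for $\Sigma'=\mathcal B_\tau^{\mathfrak m}$ (defined for $\mathcal E$-dominant $\mu$, so possessing it includes $\mathcal E$-dominance of $\mu$): every $f\in\mathbb L^\mu_{\mathrm{loc}}$ has an $\mathfrak m$-representative in $\mathrm{Lip}^1(\mathsf d,\Sigma')$. Maximal function. For $A\in\Sigma$, $\bar{\mathsf d}_{\mu,A}\colon X\to[0,\infty]$ is the $\mathfrak m$-a.e. unique $\Sigma$-measurable function such that, for every $r>0$, $\bar{\mathsf d}_{\mu,A}\wedge r$ is the $\mathfrak m$-a.e. maximal element of $\{f\in\mathbb L^\mu_{\mathrm{loc}}: f=0\ \mathfrak m\text{-a.e. on }A,\ |f|\le r\ \mathfrak m\text{-a.e.}\}$ (such a function exists). *)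

(* Defs.v *)
From HB Require Import structures.
From mathcomp Require Import all_boot all_order all_algebra.
From mathcomp Require Import all_classical all_reals all_analysis.
From mathcomp Require Import measurable_realfun.

Set Implicit Arguments.
Unset Strict Implicit.
Unset Printing Implicit Defensive.

Import Order.TTheory GRing.Theory Num.Theory.
Import numFieldNormedType.Exports.

Local Open Scope classical_set_scope.
Local Open Scope ring_scope.

(* An m-class of real functions is handled through its elements: a family of
   classes is a set of functions X -> R, invariant under m-a.e. equality.
   The elements of a class need not be Borel; the library integral of such an
   f (a supremum over simple functions below f^+ and f^-) is that of any Borel
   function m-a.e. equal to f.
   The measure m is given on the Borel sets: on a sigma-algebra between the
   Borel sets and their m-completion it has a unique extension, with the same
   negligible sets and the same classes of functions. *)

Notation borel X := (g_sigma_algebraType (@open X)).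

Section luzin.
Context {R : realType}.

(* a Hausdorff complete pseudometric space is a complete metric space *)
Definition luzin_space (X : topologicalType) : Prop :=
  hausdorff_space X /\
  exists (P : completePseudoMetricType R) (phi : P -> X),
    [/\ hausdorff_space P,
        exists2 D : set P, countable D & dense D,
        continuous phi, injective phi & range phi = setT].

End luzin.

Section distances.
Context {R : realType}.

Definition ext_pseudo_distance (X : Type) (d : X -> X -> \bar R) : Prop :=
  [/\ forall x y, (0 <= d x y)%E,
      forall x, d x x = 0%E,
      forall x y, d x y = d y x &
      forall x y z, (d x z <= d x y + d y z)%E].

Definition pseudo_distance (X : Type) (d : X -> X -> R) : Prop :=
  ext_pseudo_distance (fun x y => (d x y)%:E).

Definition dist_to (X : Type) (d : X -> X -> \bar R) (A : set X) (x : X)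
  : \bar R := ereal_inf [set d x y | y in A].

Definition uniformity (X : Type) (U : set (X -> X -> R)) : Prop :=
  [/\ U `<=` @pseudo_distance X,
      forall d e, U d -> U e -> U (fun x y => Num.max (d x y) (e x y)) &
      forall d e, U d -> pseudo_distance e -> (forall x y, e x y <= d x y) ->
        U e].

Definition admissible (X : topologicalType) (d : X -> X -> \bar R) : Prop :=
  exists U : set (X -> X -> R),
    [/\ uniformity U,
        forall e, U e -> continuous (fun p : X * X => e p.1 p.2) &
        forall x y, d x y = ereal_sup [set (e x y)%:E | e in U]].

Definition Lip1 (X : pointedType) (d : X -> X -> \bar R) (S : set (set X))
    (f : X -> R) : Prop :=
  measurable_fun [set: g_sigma_algebraType S] (f : g_sigma_algebraType S -> R)
  /\ forall x y, (`|f x - f y|%:E <= d x y)%E.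

End distances.

Section dirichlet_form.
Context {R : realType} {X : ptopologicalType}.
Variable m : {measure set (borel X) -> \bar R}.

Definition Lp (p : \bar R) (f : X -> R) : Prop :=
  exists2 g : borel X -> R, g \in Lfun m p & f = g %[ae m].

Definition L2norm (f : X -> R) : R := fine ('N[m]_2%:E [EFin \o f]).

Definition energy_norm (E : (X -> R) -> (X -> R) -> R) (f : X -> R) : R :=
  Num.sqrt (E f f + L2norm f ^+ 2).

(* values of the form outside of the domain are irrelevant *)
Record dirichlet_form := DirichletForm {
  form_dom : set (X -> R) ;
  form :> (X -> R) -> (X -> R) -> R ;
  dom_L2 : form_dom `<=` Lp 2%:E ;
  dom_ae : forall f g, form_dom f -> f = g %[ae m] -> form_dom g ;
  form_ae : forall f g h, form_dom f -> form_dom h -> f = g %[ae m] ->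
    form f h = form g h ;
  dom_linear : forall a f g, form_dom f -> form_dom g -> form_dom (a \*o f \+ g) ;
  form_linear : forall a f g h, form_dom f -> form_dom g -> form_dom h ->
    form (a \*o f \+ g) h = a * form f h + form g h ;
  form_sym : forall f g, form_dom f -> form_dom g -> form f g = form g f ;
  form_ge0 : forall f, form_dom f -> 0 <= form f f ;
  dom_dense : forall f, Lp 2%:E f -> forall e : R, 0 < e ->
    exists2 g, form_dom g & L2norm (f \- g) < e ;
  form_closed : forall u : nat -> X -> R, (forall n, form_dom (u n)) ->
    (forall e : R, 0 < e -> exists N, forall i j, (N <= i)%N -> (N <= j)%N ->
      energy_norm form (u i \- u j) < e) ->
    exists2 f, form_dom f & energy_norm form (u n \- f) @[n --> \oo] --> 0 ;
  form_markov : forall f, form_dom f ->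
    let g := fun x => Num.min (Num.max (f x) 0) 1 in
    form_dom g /\ form g g <= form f f }.

Variable E : dirichlet_form.

Local Notation dom := (form_dom E).

Definition dom_bounded : set (X -> R) := dom `&` Lp +oo%E.

(* density for the norm of the domain *)
Definition dense_in_dom (D : set (X -> R)) : Prop :=
  forall f, dom f -> forall e : R, 0 < e ->
    exists2 g, D g & energy_norm E (f \- g) < e.

Definition dom_on (A : set X) : set (X -> R) :=
  [set f | dom f /\ f = cst 0 %[ae m in ~` A]].

Definition nest (F : nat -> set X) : Prop :=
  [/\ forall n, closed (F n),
      forall n, F n `<=` F n.+1 &
      dense_in_dom (\bigcup_n dom_on (F n))].

Definition polar (N : set X) : Prop :=
  exists2 F, nest F & N `<=` ~` \bigcup_n F n.

Definition quasi_open (G : set X) : Prop :=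
  measurable (G : set (borel X)) /\
  exists2 F, nest F & forall n, open (G `&` F n : set (subspace (F n))).

Definition quasi_continuous (f : X -> R) : Prop :=
  exists2 F, nest F & forall n, {within F n, continuous f}.

Definition qc_representative (f ft : X -> R) : Prop :=
  quasi_continuous ft /\ ft = f %[ae m].

Definition quasi_regular : Prop :=
  [/\ exists2 F, nest F & forall n, compact (F n),
      exists D : set (X -> R), [/\ D `<=` dom, dense_in_dom D &
        forall f, D f -> exists ft, qc_representative f ft] &
      exists (N : set X) (u ut : nat -> X -> R),
        [/\ polar N, forall n, dom (u n),
            forall n, qc_representative (u n) (ut n) &
            forall x y, ~ N x -> ~ N y -> x <> y ->
              exists n, ut n x <> ut n y]].

(* support of the class of f, i.e. of the measure |f| m *)
Definition supp (f : X -> R) : set X :=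
  ~` \bigcup_(U in [set U | open U /\ f = cst 0 %[ae m in U]]) U.

Definition strongly_local : Prop :=
  forall f g, dom f -> dom g -> compact (supp f) -> compact (supp g) ->
    (exists (U : set X) (c : R),
      [/\ open U, supp g `<=` U & f = cst c %[ae m in U]]) ->
    E f g = 0.

(* polar (A `\` B): A is contained in B quasi-everywhere *)
Definition exhaustion (G : nat -> set X) : Prop :=
  [/\ forall n, quasi_open (G n),
      forall n, polar (G n `\` G n.+1) &
      polar (~` \bigcup_n G n)].

Definition broad_loc (A : set (X -> R)) : set (X -> R) :=
  [set f | exists (G : nat -> set X) (u : nat -> X -> R),
    [/\ exhaustion G, forall n, A (u n) &
        forall n, f = u n %[ae m in G n]]].

Definition not_charging_polar (mu : set (borel X) -> \bar R) : Prop :=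
  forall N : set (borel X), measurable N -> polar N -> mu N = 0%E.

(* a measure satisfying P; mzero is only a value for the case without any *)
Definition the_measure (P : {measure set (borel X) -> \bar R} -> Prop)
  : {measure set (borel X) -> \bar R} :=
  if pselect (exists nu, P nu) is left e then projT1 (cid e) else mzero.

Definition is_energy_measure_b (f : X -> R)
    (nu : {measure set (borel X) -> \bar R}) : Prop :=
  [/\ (nu setT < +oo)%E, not_charging_polar nu &
      forall h ht, dom_bounded h -> qc_representative h ht ->
        (\int[nu]_x (ht x)%:E)%E = (2 * E (f \* h) f - E (f \* f) h)%R%:E].

Definition energy_measure_b (f : X -> R) :=
  the_measure (is_energy_measure_b f).

Definition is_energy_measure (f : X -> R)
    (nu : {measure set (borel X) -> \bar R}) : Prop :=
  exists (G : nat -> set X) (u : nat -> X -> R),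
    [/\ exhaustion G, forall n, dom_bounded (u n),
        forall n, f = u n %[ae m in G n] &
        forall B : set (borel X), measurable B ->
          energy_measure_b (u n) (B `&` G n) @[n --> \oo] --> nu B].

Definition energy_measure (f : X -> R) := the_measure (is_energy_measure f).

Definition dominant (mu : set (borel X) -> \bar R) : Prop :=
  forall f, dom f -> energy_measure f `<< mu.

Definition moderate (mu : set (borel X) -> \bar R) : Prop :=
  exists (G : nat -> set X) (e et : nat -> X -> R),
    exhaustion G /\
    forall n, [/\ dom (e n), \forall x \ae m, 0 <= e n x <= 1,
      e n = cst 1 %[ae m in G n], qc_representative (e n) (et n) &
      (\int[mu]_x (et n x)%:E < +oo)%E].

(* functions in the broad local space whose energy measure is at most mu *)
Definition Lloc (mu : set (borel X) -> \bar R) : set (X -> R) :=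
  [set f | broad_loc dom f /\
    forall B : set (borel X), measurable B -> (energy_measure f B <= mu B)%E].

Definition Lloc_cb (mu : set (borel X) -> \bar R) : set (X -> R) :=
  [set f | [/\ Lloc mu f, continuous f & bounded_fun f]].

Definition intrinsic_dist (mu : set (borel X) -> \bar R) (x y : X) : \bar R :=
  ereal_sup [set (f x - f y)%:E | f in Lloc_cb mu].

Definition rademacher (S : set (set X)) (d : X -> X -> \bar R)
    (mu : set (borel X) -> \bar R) : Prop :=
  forall f, Lip1 d S f -> broad_loc (Lp +oo%E) f -> Lloc mu f.

Definition sobolev_to_lipschitz (S : set (set X)) (d : X -> X -> \bar R)
    (mu : set (borel X) -> \bar R) : Prop :=
  dominant mu /\
  forall f, Lloc mu f -> exists2 g, g = f %[ae m] & Lip1 d S g.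

(* the functions competing for the maximal function truncated at r *)
Definition competitor (mu : set (borel X) -> \bar R) (A : set X) (r : R)
  : set (X -> R) :=
  [set f | [/\ Lloc mu f, f = cst 0 %[ae m in A] &
              \forall x \ae m, `|f x| <= r]].

(* Competitors are stable under pairwise maxima: an m-a.e. maximal one is
   m-a.e. greatest. *)
Definition is_maximal_function (S : set (set X))
    (mu : set (borel X) -> \bar R) (A : set X) (g : X -> \bar R) : Prop :=
  [/\ forall x, (0 <= g x)%E,
      measurable_fun [set: g_sigma_algebraType S]
        (g : g_sigma_algebraType S -> \bar R) &
      forall r : R, 0 < r ->
        let gr := fun x => fine (mine (g x) r%:E) in
        competitor mu A r gr /\
        forall f, competitor mu A r f -> \forall x \ae m, f x <= gr x].

Definition maximal_function (S : set (set X)) (mu : set (borel X) -> \bar R)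
    (A : set X) : X -> \bar R :=
  xget (fun=> 0%E) [set g | is_maximal_function S mu A g].

Definition full_support : Prop :=
  forall U : set X, open U -> U !=set0 -> (0 < m U)%E.

End dirichlet_form.

(* Main.v *)
Require Import Defs.
From HB Require Import structures.
From mathcomp Require Import all_boot all_order all_algebra.
From mathcomp Require Import all_classical all_reals all_analysis.
From mathcomp Require Import measurable_realfun.

Set Implicit Arguments.
Unset Strict Implicit.
Unset Printing Implicit Defensive.

Import Order.TTheory GRing.Theory Num.Theory.
Import numFieldNormedType.Exports.

Local Open Scope classical_set_scope.
Local Open Scope ring_scope.

(** The form enters only through two facts about Lipschitz functions: bounded
[d]-Lipschitz functions belong to the local space of energy measure at most
[mu] (Rademacher), and functions of that space have [d]-Lipschitz
representatives (Sobolev-to-Lipschitz).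

Fix [A].  A competitor [f] for the maximal function of [A] has a [d]-Lipschitz
representative that vanishes almost everywhere on [A].  If it vanished
everywhere on a subset [At] of [A], then [f <= d(., At)] would follow.  The
exceptional subset of [A] depends on [f], and there are uncountably many
competitors; but [m] is sigma-finite, so countably many of them have the
essential supremum of all ([ess_sup_family]).  Removing from [A] the
exceptional null sets of these leaves a set [At] such that every competitor is
almost everywhere at most [d(., At)] ([competitors_le_dist_to]).  Conversely
[d(., At)] truncated at [r] is bounded, [d]-Lipschitz, measurable and zero on
[At], hence a competitor by the Rademacher property.  So [d(., At)] has a
version that is a maximal function of [At] ([is_maximal_function_dist_to]), and
the maximal functions of [A] and [At] agree because [A] and [At] have the same
competitors.

For the intrinsic distance [d_mu], the inequality [d <= d_mu] holds everywhere:
[d] is a supremum of continuous pseudo-distances [e], and the truncations of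
[e(., y)] are bounded, continuous and [d]-Lipschitz ([intrinsic_dist_ge]).  The
converse holds off a null set: since [X] is the continuous image of a separable
metric space, countably many functions [f] realise the supremum of
[f(x) - f(y)] at all pairs of points ([countable_sup_continuous]), and each of
them coincides with a [d]-Lipschitz function off a null set
([intrinsic_dist_le_ae]).  Once this null set is removed from [At] as well,
[d_mu(., At)] and [d(., At)] agree almost everywhere. *)

Lemma rat_between_ereal (R : realType) (x y : \bar R) :
  (x < y)%E -> exists q : rat, (x < (ratr q)%:E < y)%E.
Proof.
case: x y => [x| |] [y| |] //=.
- rewrite lte_fin => /rat_in_itvoo[q]; rewrite in_itv/= => xqy.
  by exists q; rewrite !lte_fin.
- move=> _; have /rat_in_itvoo[q] : x < x + 1 by rewrite ltrDl.
  by rewrite in_itv/= => /andP[xq _]; exists q; rewrite lte_fin xq ltey.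
- move=> _; have /rat_in_itvoo[q] : y - 1 < y by rewrite ltrBlDr ltrDl.
  by rewrite in_itv/= => /andP[_ qy]; exists q; rewrite lte_fin qy ltNye.
- by move=> _; exists 0; rewrite ltNye ltey.
Qed.

(** * Measurability for the completion *)

Section completion.
Context d (T : measurableType d) (R : realType).
Context (m : {measure set T -> \bar R}).

Lemma completed_measurable_ae (S : set T) :
  <<s completed_algebra_gen m >> S ->
  exists2 B, measurable B & m.-negligible (S `+` B).
Proof.
move: S; apply: smallest_sub; last first.
  move=> _ [B mB [N N0 <-]]; exists B => //.
  by apply: negligibleS N0 => x [[[Bx|//] //]|[Bx] []]; left.
split.
- by exists set0 => //; apply: negligibleS (negligible_set0 m) => x [[]|[]].
- move=> S [B mB SB]; exists (~` B); first exact: measurableC.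
  apply: negligibleS SB => x [] [] /=.
    by move=> [_ Sx] /contrapT Bx; right.
  by move=> nBx /not_andP[//|/contrapT Sx]; left.
- move=> F FB.
  have [B mB] : exists2 B : nat -> set T, (forall n, measurable (B n)) &
      forall n, m.-negligible (F n `+` B n).
    exists (fun n => projT1 (cid2 (FB n))) => n; by case: cid2.
  move=> FB0; exists (\bigcup_n B n); first exact: bigcupT_measurable.
  apply: negligibleS (negligible_bigcup FB0) => x [] [] [n _ ?] nB;
    exists n => //.
    by left; split => // ?; apply: nB; exists n.
  by right; split => // ?; apply: nB; exists n.
Qed.

(** The version is the supremum of the rationals [q] such that [x] belongs to a
measurable set that is almost everywhere the superlevel set of [f] at [q]. *)
Lemma ae_measurable_version (f : T -> \bar R) :
  measurable_fun [set: g_sigma_algebraType (completed_algebra_gen m)]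
    (f : g_sigma_algebraType (completed_algebra_gen m) -> \bar R) ->
  exists2 g : T -> \bar R, measurable_fun [set: T] g & f = g %[ae m].
Proof.
move=> mf.
have [B mB fB] : exists2 B : rat -> set T, (forall q, measurable (B q)) &
    forall q, m.-negligible ([set x | (ratr q)%:E < f x]%E `+` B q).
  have h q : exists2 C : set T, measurable C &
      m.-negligible ([set x | (ratr q)%:E < f x]%E `+` C).
    apply: completed_measurable_ae.
    by have := emeasurable_fun_o_infty measurableT mf (ratr q)%:E;
      rewrite setTI.
  by exists (fun q => projT1 (cid2 (h q))) => q; case: cid2.
pose qn n : rat := odflt 0 (unpickle n).
pose u n x : \bar R := if x \in B (qn n) then (ratr (qn n))%:E else -oo%E.
exists (fun x => esups (u^~ x) 0%N).
  apply: measurable_fun_esups => n; apply: measurable_fun_ifT => //.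
  apply: (measurable_fun_bool true); rewrite setTI.
  rewrite [X in measurable X](_ : _ = B (qn n)) //.
  by apply/seteqP; split => x /=; [exact: set_mem|exact: mem_set].
have : m.-negligible
    (\bigcup_n ([set x | (ratr (qn n))%:E < f x]%E `+` B (qn n))).
  exact: negligible_bigcup.
apply: negligibleS => x /= /not_implyP[_]; apply: contra_notP => nx.
have fE n : (x \in B (qn n)) = ((ratr (qn n))%:E < f x)%E.
  apply/idP/idP; rewrite inE => h; apply: contrapT => nh; apply: nx.
    by exists n => //; right.
  by exists n => //; left.
apply/eqP; rewrite eq_le; apply/andP; split; last first.
  apply: ge_ereal_sup => _ [n _ <-]; rewrite /u fE.
  by case: ifPn => [/ltW//|_]; rewrite leNye.
rewrite leNgt; apply/negP => /rat_between_ereal[q /andP[sq qf]].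
move: sq; rewrite ltNge => /negP; apply.
apply: ereal_sup_ubound; exists (pickle q) => //.
by rewrite /u fE /qn pickleK /= qf.
Qed.

End completion.

(** * Essential suprema of arbitrary families *)

Section essential_supremum_family.
Context d (T : measurableType d) (R : realType).
Context (m : {sigma_finite_measure set T -> \bar R}).

(** A nonempty family of measurable sets has a countable subfamily whose union
contains each member up to a null set.  The measures in [F k], a set of finite
measure, of the countable unions of members have a finite supremum; the union
[V w] of maximising sequences attains it for all [k], so that adding one more
member does not increase its measure in [F k]. *)
Lemma ess_union_family (I : Type) (H : set I) (D : I -> set T) :
  H !=set0 -> (forall i, H i -> measurable (D i)) ->
  exists2 i_ : nat -> I, (forall n, H (i_ n)) &
    forall i, H i -> m.-negligible (D i `\` \bigcup_n D (i_ n)).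
Proof.
move=> [i0 Hi0] mD.
have [F TF mF] := sigma_finiteT m.
pose V (s : nat -> I) := \bigcup_n D (s n).
have mV s : (forall n, H (s n)) -> measurable (V s).
  by move=> Hs; apply: bigcupT_measurable => n; exact: mD.
pose S k := [set m (F k `&` V s) | s in [set s | forall n, H (s n)]].
have Sfin k : ereal_sup (S k) \is a fin_num.
  have S0 : S k (m (F k `&` V (fun=> i0))) by exists (fun=> i0).
  rewrite ge0_fin_numE; last exact: le_trans (ereal_sup_ubound S0).
  apply: le_lt_trans (mF k).2; apply: ge_ereal_sup => _ [s /= Hs <-].
  apply: le_measure; rewrite ?inE//; last exact: (mF k).1.
  by apply: measurableI; [exact: (mF k).1|exact: mV].
have appr k j : exists s, (forall n, H (s n)) /\
    (ereal_sup (S k) - (j.+1%:R^-1)%:E < m (F k `&` V s))%E.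
  have j0 : 0 < j.+1%:R^-1 :> R by rewrite invr_gt0.
  have [_ [s Hs <-] hs] := ub_ereal_sup_adherent j0 (Sfin k).
  by exists s.
pose t k j := projT1 (cid (appr k j)).
have Ht k j n : H (t k j n) by rewrite /t; case: cid => ? [].
have tS k j : (ereal_sup (S k) - (j.+1%:R^-1)%:E < m (F k `&` V (t k j)))%E.
  by rewrite /t; case: cid => ? [].
pose w n := let: (k, j, l) := odflt (0, 0, 0)%N (unpickle n) in t k j l.
have Hw n : H (w n) by rewrite /w; case: (odflt _ _) => -[k j] l; exact: Ht.
have tw k j : V (t k j) `<=` V w.
  by move=> x [l _ Dx]; exists (pickle (k, j, l)) => //; rewrite /w pickleK.
exists w => // i Hi.
have -> : D i `\` V w = \bigcup_k (F k `&` (D i `\` V w)).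
  by rewrite -setI_bigcupl -TF setTI.
apply: negligible_bigcup => k.
have mFk := (mF k).1.
have mDV : measurable (D i `\` V w).
  by apply: measurableD; [exact: mD|exact: mV].
apply/negligibleP; first exact: measurableI.
(* [V s] is the union of [V w] and of the additional member [D i] *)
pose s n := if n is n'.+1 then w n' else i.
have Hs n : H (s n) by case: n => //=.
have VsE : V s = V w `|` (D i `\` V w).
  apply/seteqP; split => x.
    move=> [[|n] _ /= Dx]; last by left; exists n.
    by have [?|?] := pselect (V w x); [left|right].
  move=> [[n _ Dx]|[Dx _]]; first by exists n.+1.
  by exists 0%N.
have mFV : (m (F k `&` V w) < +oo)%E.
  apply: le_lt_trans (mF k).2; apply: le_measure; rewrite ?inE//.
  by apply: measurableI => //; exact: mV.
have le1 : (m (F k `&` V s) <= m (F k `&` V w))%E.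
  apply: (@le_trans _ _ (ereal_sup (S k))).
    by apply: ereal_sup_ubound; exists s.
  apply/lee_addgt0Pr => e e0.
  have [j je] : exists j, j.+1%:R^-1 < e.
    by have [j _ /(_ j (leqnn _)) h] := near_infty_natSinv_lt (PosNum e0);
      exists j.
  rewrite -leeBlDr//; apply: (@le_trans _ _ (m (F k `&` V (t k j)))).
    by apply: le_trans (ltW (tS k j)); rewrite leeB// lee_fin ltW.
  apply: le_measure; rewrite ?inE; [| |exact: setIS].
    by apply: measurableI => //; exact: mV.
  by apply: measurableI => //; exact: mV.
move: le1; rewrite VsE setIUr measureU//; last 3 first.
- by apply: measurableI => //; exact: mV.
- exact: measurableI.
- by apply/seteqP; split => x //= [[_ Vx] [_ [_]]].
rewrite addeC -leeBrDr ?ge0_fin_numE// subee ?ge0_fin_numE// => h.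
by apply/eqP; rewrite eq_le h/=.
Qed.

(** The essential supremum of a nonempty family of functions is that of a
countable subfamily: apply the lemma on unions to the superlevel sets at every
rational. *)
Lemma ess_sup_family (H : set (T -> \bar R)) :
  H !=set0 -> (forall h, H h -> measurable_fun [set: T] h) ->
  exists2 h_ : nat -> T -> \bar R, (forall n, H (h_ n)) &
    forall h, H h ->
      \forall x \ae m, (h x <= ereal_sup (range (h_^~ x)))%E.
Proof.
move=> H0 mH.
pose D (q : rat) (h : T -> \bar R) := [set x | ((ratr q)%:E < h x)%E].
have mD q h : H h -> measurable (D q h).
  move=> Hh; have := emeasurable_fun_o_infty measurableT (mH h Hh) (ratr q)%:E.
  by rewrite setTI.
pose h q := cid2 (ess_union_family H0 (mD q)).
pose w n := let: (q, j) := odflt (0, 0%N) (unpickle n) in projT1 (h q) j.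
exists w => [n|g Hg].
  by rewrite /w; case: (odflt _ _) => q j; case: (h q) => u /=.
pose qn n : rat := odflt 0 (unpickle n).
have h0 n : m.-negligible
    (D (qn n) g `\` \bigcup_j D (qn n) (projT1 (h (qn n)) j)).
  by case: (h (qn n)) => /= u Hu /(_ g Hg).
apply: negligibleS (negligible_bigcup h0) => x /= /negP.
rewrite -ltNge => /rat_between_ereal[q /andP[sq qg]].
exists (pickle q) => //; rewrite /qn pickleK/=; split => //= -[j _ /= qj].
move: sq; rewrite ltNge => /negP; apply; apply: le_trans (ltW qj) _.
by apply: ereal_sup_ubound; exists (pickle (q, j)) => //; rewrite /w pickleK.
Qed.

End essential_supremum_family.

(** * Countable suprema of continuous functions *)

Lemma separable_second_countable (R : realType) (T : pseudoMetricType R)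
    (D : set T) : countable D -> dense D -> @second_countable T.
Proof.
move=> cD dD.
pose f n (z : T) : set T := (ball z n.+1%:R^-1)°.
exists (\bigcup_n (f n) @` D).
  by apply: bigcup_countable => // n _;
    apply: card_le_trans (card_image_le _ _) cD.
split.
  by move=> ? [? _ [? _ <-]]; exact: open_interior.
move=> x V /nbhs_ballP[] _/posnumP[e] xV.
have [N Ne] : exists N, N.+1%:R^-1 < e%:num / 2 :> R.
  have e2 : 0 < e%:num / 2 :> R by [].
  by have [j _ /(_ j (leqnn _)) h] := near_infty_natSinv_lt (PosNum e2);
    exists j.
have N0 : 0 < N.+1%:R^-1 / 2 :> R by rewrite divr_gt0// invr_gt0.
(* balls need not be open: the point [w] is taken within half the radius, so
   that [x] is interior to the ball around [w] *)
have [|w [xw Dw]] := dD (ball x (N.+1%:R^-1 / 2))° _ (open_interior _).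
  by exists x; exact: nbhsx_ballx.
have {}xw := interior_subset xw.
exists (f N w); first split => //; first by exists N => //; exists w.
  apply/nbhs_ballP; exists (N.+1%:R^-1 / 2) => //= z xz.
  rewrite [_^-1]splitr; exact: ball_triangle (ball_sym xw) xz.
move=> z /interior_subset wz; apply: xV.
rewrite [_%:num]splitr; apply: (@ball_triangle _ _ w).
  apply: le_ball xw; apply: le_trans (ltW Ne).
  by rewrite ler_pdivrMr// ler_peMr// ?invr_ge0// ler1n.
by apply: le_ball wz; exact: ltW.
Qed.

Lemma second_countable_prod (S T : topologicalType) :
  @second_countable S -> @second_countable T -> @second_countable (S * T)%type.
Proof.
move=> [B cB [oB nB]] [C cC [oC nC]].
exists ((fun U => U.1 `*` U.2) @` (B `*` C)).
  by apply: card_le_trans (card_image_le _ _) _; exact: countableX.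
split.
  move=> _ [[U V] [/= BU CV] <-]; rewrite openE => -[x y] [/= Ux Vy].
  by exists (U, V) => //; split; apply: open_nbhs_nbhs; split => //;
    [exact: oB|exact: oC].
move=> [x y] W /= [[P Q]/= [Px Qy] PQW].
have [U [BU Ux] UP] := nB x P Px.
have [V [CV Vy] VQ] := nC y Q Qy.
exists (U `*` V); first by split => //; exists (U, V).
by move=> [u v] [/= /UP Pu /VQ Qv]; exact: PQW.
Qed.

(** A nonempty family of continuous functions on a second countable space has a
countable subfamily with the same pointwise supremum: for every basic open
set [U] and every rational [q] such that some member is above [q] on [U], one
such member is selected. *)
Lemma countable_sup_continuous (R : realType) (T : topologicalType) (I : Type)
    (H : set I) (f : I -> T -> R) :
  @second_countable T -> H !=set0 -> (forall i, H i -> continuous (f i)) ->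
  exists2 i_ : nat -> I, (forall n, H (i_ n)) &
    forall i x, H i ->
      ((f i x)%:E <= ereal_sup [set (f (i_ n) x)%:E | n in setT])%E.
Proof.
move=> [B /countable_injP[/= b] b_inj [oB nB]] [i0 Hi0] cf.
pose below (kq : nat * rat) i :=
  exists U, [/\ B U, b U = kq.1 & forall y, U y -> ratr kq.2 < f i y].
have sel kq : exists i, H i /\ forall j, H j -> below kq j -> below kq i.
  have [[j [Hj jb]]|nj] := pselect (exists j, H j /\ below kq j).
    by exists j.
  by exists i0; split => // j Hj jb; exfalso; apply: nj; exists j.
pose i_ kq := projT1 (cid (sel kq)).
exists (fun n => i_ (odflt (0%N, 0) (unpickle n))).
  by move=> n; rewrite /i_; case: cid => i [].
move=> i x Hi; rewrite leNgt; apply/negP => /rat_between_ereal[q /andP[sq]].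
rewrite lte_fin => qi.
have [U [BU Ux] Uq] :
    filter_from [set U | B U /\ U x] id [set y | ratr q < f i y].
  by apply: nB; exact: cvgr_gt (cf i Hi x) _ qi.
have [V [BV VU Vq]] : below (b U, q) (i_ (b U, q)).
  have [_ below_sel] := projT2 (cid (sel (b U, q))).
  by apply: (below_sel i Hi); exists U.
have {}VU : V = U by apply: b_inj => //; rewrite inE.
move: sq; rewrite ltNge => /negP; apply.
apply: (@le_trans _ _ (f (i_ (b U, q)) x)%:E).
  by rewrite lee_fin ltW//; apply: Vq; rewrite VU.
by apply: ereal_sup_ubound; exists (pickle (b U, q)) => //; rewrite pickleK.
Qed.

(** * Truncations and distance to a set *)

(** The truncation of [g] from above at the level [r], as a real function.  It
is meaningful for [0 <= g] and [0 <= r]; the minimum is then finite, and [fine]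
only changes its type. *)
Definition trunc (R : realType) (X : Type) (r : R) (g : X -> \bar R) (x : X)
  : R :=
  fine (mine (g x) r%:E).

Section truncation.
Context (R : realType) (X : Type).
Implicit Types (r : R) (g : X -> \bar R) (d : X -> X -> \bar R).

Lemma EFin_trunc r g x : (0 <= g x)%E -> 0 <= r ->
  (trunc r g x)%:E = mine (g x) r%:E.
Proof.
move=> g0 r0; rewrite /trunc fineK// ge0_fin_numE ?le_min ?g0//.
by rewrite (@le_lt_trans _ _ r%:E) ?ltey// ge_min lexx orbT.
Qed.

Lemma trunc_ge0 r g x : (0 <= g x)%E -> 0 <= r -> 0 <= trunc r g x.
Proof. by move=> g0 r0; rewrite -lee_fin EFin_trunc// le_min g0. Qed.

Lemma trunc_le r g x : (0 <= g x)%E -> 0 <= r -> trunc r g x <= r.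
Proof. by move=> g0 r0; rewrite -lee_fin EFin_trunc// ge_min lexx orbT. Qed.

Lemma normr_trunc_le r g x : (0 <= g x)%E -> 0 <= r -> `|trunc r g x| <= r.
Proof. by move=> g0 r0; rewrite ger0_norm ?trunc_ge0// trunc_le. Qed.

Lemma trunc_lipschitz r g d : (forall x, 0 <= g x)%E -> 0 <= r ->
  ext_pseudo_distance d -> (forall x y, g x <= d x y + g y)%E ->
  forall x y, (`|trunc r g x - trunc r g y|%:E <= d x y)%E.
Proof.
move=> g0 r0 [d0 _ dC _] gd x y.
have half u v : ((trunc r g u)%:E - (trunc r g v)%:E <= d u v)%E.
  rewrite leeBlDr// !EFin_trunc//.
  have [_|_] := leP (g v) r%:E; rewrite ge_min; first by rewrite gd.
  by rewrite leeDr ?d0 ?orbT.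
case: ger0P => _; first by rewrite EFinB; exact: half.
by rewrite opprB EFinB dC; exact: half.
Qed.

Lemma measurable_trunc disp (T : measurableType disp) r (g : T -> \bar R) :
  measurable_fun setT g -> measurable_fun setT (trunc r g).
Proof.
move=> mg; rewrite -[trunc r g]/(fine \o (fun x => mine (g x) r%:E)).
apply: measurableT_comp.
  exact: fine_measurable.
exact: measurable_mine.
Qed.

End truncation.

Section distance_to_set.
Context (R : realType) (X : Type) (d : X -> X -> \bar R).
Context (d_dist : ext_pseudo_distance d).

Lemma dist_to_ge0 A x : (0 <= dist_to d A x)%E.
Proof. by apply/ereal_infP => _ [y _ <-]; case: d_dist. Qed.

Lemma dist_to_in A x : A x -> dist_to d A x = 0%E.
Proof.
move=> Ax; apply/eqP; rewrite eq_le dist_to_ge0 andbT.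
by apply: ereal_inf_lbound; exists x => //; case: d_dist.
Qed.

Lemma dist_to_triangle A x y : (dist_to d A x <= d x y + dist_to d A y)%E.
Proof.
case: d_dist => d0 _ _ dT.
have [->|dyx] := eqVneq (d x y) +oo%E.
  by rewrite addye ?leey// gt_eqF// (lt_le_trans ltNy0 (dist_to_ge0 _ _)).
have dfin : d x y \is a fin_num by rewrite ge0_fin_numE// ltey.
rewrite -leeBlDl//; apply/ereal_infP => _ [z Az <-].
rewrite leeBlDl//; apply: le_trans (dT x y z).
by apply: ereal_inf_lbound; exists z.
Qed.

Lemma Lip_le_dist_to (f : X -> R) A x :
  (forall x y, (`|f x - f y|%:E <= d x y)%E) -> (forall y, A y -> f y = 0) ->
  ((f x)%:E <= dist_to d A x)%E.
Proof.
move=> fd fA; apply/ereal_infP => _ [y Ay <-]; apply: le_trans (fd x y).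
by rewrite (fA y Ay) subr0 lee_fin ler_norm.
Qed.

End distance_to_set.

(** * Bounded Lipschitz functions in the local space *)

(** The almost-everywhere filter of a Borel measure, as an instance at the type
[borel X] itself. *)
#[local] Instance ae_filter_borel (R : realType) (X : ptopologicalType)
  (m : {measure set (borel X) -> \bar R}) : Filter (nbhs (almost_everywhere m)).
Proof. exact: ae_filter_ringOfSetsType. Qed.

Section broad_local.
Context (R : realType) (X : ptopologicalType).
Context (m : {measure set (borel X) -> \bar R}) (E : dirichlet_form m).

Lemma Lp_bounded (f : X -> R) (r : R) :
  measurable_fun [set: g_sigma_algebraType (completed_algebra_gen m)]
    (f : g_sigma_algebraType (completed_algebra_gen m) -> R) ->
  (forall x, `|f x| <= r) -> Lp m +oo%E f.
Proof.
move=> /measurable_EFinP /ae_measurable_version[g mg fg] fr.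
have fg' : f = fine \o g %[ae m].
  by apply: filterS fg => x h xT /=; rewrite -(h xT).
exists (fine \o g) => //; apply/andP; split; rewrite inE/=.
  by apply: measurableT_comp => //; exact: fine_measurable.
rewrite /finite_norm unlock; case: ifPn => // _.
apply: (@le_lt_trans _ _ r%:E); last by rewrite ltey.
apply/ess_sup_inf.ess_supP; apply: filterS fg' => x /(_ I)/= <-.
by rewrite lee_fin.
Qed.

Lemma nest_setT : nest E (fun=> setT).
Proof.
split=> // f fE e e0; exists f.
  by exists 0%N => //; split => //; apply: aeW => x; rewrite setCT.
have ff : f \- f = -1 \*o f \+ f.
  by apply/funext => x /=; rewrite mulN1r addNr subrr.
have Eh h : form_dom E h -> E (f \- f) h = 0.
  by move=> hE; rewrite ff form_linear// mulN1r addNr.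
rewrite /energy_norm Eh; last by rewrite ff; exact: dom_linear.
rewrite /L2norm (_ : EFin \o _ = cst 0%E) ?Lnorm0 ?sqrtr0//=.
  by rewrite expr0n addr0 sqrtr0.
by apply/funext => x /=; rewrite subrr.
Qed.

Lemma polar_set0 : polar E set0.
Proof. by exists (fun=> setT) => //; exact: nest_setT. Qed.

Lemma exhaustion_setT : exhaustion E (fun=> setT).
Proof.
split=> [_|_|].
- split; first exact: measurableT.
  exists (fun=> setT); first exact: nest_setT.
  by move=> _; rewrite setTI; exact: openT.
- by rewrite setDv; exact: polar_set0.
- by rewrite bigcup_const ?setCT; [exact: polar_set0|exists 0%N].
Qed.

Lemma sub_broad_loc (A : set (X -> R)) : A `<=` broad_loc E A.
Proof.
move=> f Af; exists (fun=> setT), (fun=> f); split => // [|_].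
  exact: exhaustion_setT.
exact: aeW.
Qed.

(** Membership in the local space depends only on the class of the function: the
energy measure is chosen from a predicate in which the function only occurs
through almost everywhere equalities. *)
Lemma Lloc_ae mu (f g : X -> R) : f = g %[ae m] -> Lloc E mu f -> Lloc E mu g.
Proof.
move=> fg [fE fmu].
have swap (G : nat -> set X) (u : nat -> X -> R) :
    (forall n, f = u n %[ae m in G n]) <-> (forall n, g = u n %[ae m in G n]).
  split => h n; apply: filterS2 fg (h n).
    by move=> x <-.
  by move=> x ->.
split.
  by case: fE => G [u [GE uE /swap fu]]; exists G, u.
suff <- : energy_measure E f = energy_measure E g by [].
congr the_measure; apply/funext => nu; apply/propext.
by split => -[G [u [GE uE /swap fu nuE]]]; exists G, u.
Qed.

Lemma Lip1_bounded_Lloc d mu (f : X -> R) (r : R) :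
  rademacher E (completed_algebra_gen m) d mu ->
  Lip1 d (completed_algebra_gen m) f -> (forall x, `|f x| <= r) ->
  Lloc E mu f.
Proof.
move=> Rad fd fr; apply: Rad => //; apply: sub_broad_loc.
exact: Lp_bounded fd.1 fr.
Qed.

Lemma borel_completed (A : set X) : measurable (A : set (borel X)) ->
  <<s completed_algebra_gen m >> A.
Proof.
move=> mA; apply: sub_sigma_algebra; exists A => //; exists set0 => //.
  exact: negligible_set0.
by rewrite setU0.
Qed.

Lemma continuous_completed_measurable (f : X -> R) : continuous f ->
  measurable_fun [set: g_sigma_algebraType (completed_algebra_gen m)]
    (f : g_sigma_algebraType (completed_algebra_gen m) -> R).
Proof.
move=> /continuousP cf; apply: (measurability _ (RGenOpens.measurableE R)).
move=> _ [_ [a [b ->]] <-]; rewrite setTI; apply: borel_completed.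
by apply: sub_sigma_algebra; apply: cf; exact: interval_open.
Qed.

End broad_local.

(** * Comparison with the intrinsic distance *)

Section intrinsic_distance.
Context (R : realType) (X : ptopologicalType).
Context (m : {measure set (borel X) -> \bar R}) (E : dirichlet_form m).
Context (d : X -> X -> \bar R) (mu : set (borel X) -> \bar R).

(** For [e] continuous with [e <= d], the function [e(., y)] truncated at
[e x y] competes in the definition of the intrinsic distance between [x]
and [y]. *)
Lemma intrinsic_dist_ge :
  ext_pseudo_distance d -> rademacher E (completed_algebra_gen m) d mu ->
  admissible d -> forall x y, (d x y <= intrinsic_dist E mu x y)%E.
Proof.
move=> dd Rad [U [[Upd _ _] cU dE]] x y.
rewrite dE; apply: ge_ereal_sup => _ [e Ue <-].
have [e0 exx eC eT] := Upd e Ue.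
pose r := e x y; pose ey z : \bar R := (e z y)%:E.
have r0 : 0 <= r by have := e0 x y; rewrite lee_fin.
have ey0 z : (0 <= ey z)%E by exact: e0.
have tE z : trunc r ey z = Num.min (e z y) r.
  by apply: EFin_inj; rewrite EFin_trunc// EFin_min.
have -> : e x y = trunc r ey x - trunc r ey y.
  have [eyy] := exx y; rewrite !tE eyy minxx min_l ?subr0//.
apply: ereal_sup_ubound; exists (trunc r ey) => //.
have ct : continuous (trunc r ey).
  have -> : trunc r ey = (fun z => Num.min (e z y) r) by exact/funext.
  move=> z; apply: continuous_min; last exact: cvg_cst.
  apply: (@continuous_comp _ _ _ (fun z => (z, y)) (fun p => e p.1 p.2)).
    by apply: cvg_pair => //; exact: cvg_cst.
  exact: cU.
have bt z : `|trunc r ey z| <= r by exact: normr_trunc_le.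
split=> //; last first.
  by exists r; split => [|s rs z _]; [exact: num_real|exact: le_trans (ltW rs)].
apply: (Lip1_bounded_Lloc Rad _ bt); split.
  exact: continuous_completed_measurable.
move=> z w; apply: (@le_trans _ _ (e z w)%:E).
  by apply: (@trunc_lipschitz _ _ r ey (fun x y => (e x y)%:E)) => // *;
    exact: eT.
by rewrite dE; apply: ereal_sup_ubound; exists e.
Qed.

(** The null set [N] does not depend on the pair of points: it collects the
exceptional null sets of countably many functions that suffice to define the
intrinsic distance. *)
Lemma intrinsic_dist_le_ae : @luzin_space R X ->
  ext_pseudo_distance d ->
  sobolev_to_lipschitz E (completed_algebra_gen m) d mu ->
  exists2 N : set (borel X), m.-negligible N &
    forall x y, ~ N x -> ~ N y -> (intrinsic_dist E mu x y <= d x y)%E.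
Proof.
move=> [_ [P [phi [_ [D cD dD] cphi _ phi_surj]]]] [d0 _ _ _] [_ SL].
have [H0|H0] := pselect (Lloc_cb E mu !=set0); last first.
  exists set0; first exact: negligible_set0.
  move=> x y _ _; apply: ge_ereal_sup => _ [f fH <-].
  by exfalso; apply: H0; exists f.
(* The difference is continuous on the square of [X]; it is pulled back to the
   square of [P], which is second countable. *)
pose Phi (f : X -> R) (p : P * P) := f (phi p.1) - f (phi p.2).
have cPhi f : Lloc_cb E mu f -> continuous (Phi f).
  move=> [_ cf _] p; apply: cvgB.
    apply: (@continuous_comp _ _ _ fst (f \o phi)); first exact: cvg_fst.
    by apply: continuous_comp; [exact: cphi|exact: cf].
  apply: (@continuous_comp _ _ _ snd (f \o phi)); first exact: cvg_snd.
  by apply: continuous_comp; [exact: cphi|exact: cf].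
have scP := separable_second_countable cD dD.
have [f_ Hf_ Phi_sup] :=
  countable_sup_continuous (second_countable_prod scP scP) H0 cPhi.
have rep n : exists2 g : X -> R, g = f_ n %[ae m] &
    forall x y, (`|g x - g y|%:E <= d x y)%E.
  by have [g gf [_ gd]] := SL _ (let: And3 h _ _ := Hf_ n in h); exists g.
pose N n := [set x | projT1 (cid2 (rep n)) x <> f_ n x].
have N0 n : m.-negligible (N n).
  rewrite /N; case: cid2 => g /= gf _; apply: negligibleS gf => x /= gx.
  by move=> /(_ I).
exists (\bigcup_n N n); first exact: negligible_bigcup.
move=> x y Nx Ny; apply: ge_ereal_sup => _ [f fH <-].
have [p _ px] : range phi x by rewrite phi_surj.
have [q _ qy] : range phi y by rewrite phi_surj.
have := Phi_sup f (p, q) fH; rewrite /Phi /= px qy => /le_trans; apply.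
apply: ge_ereal_sup => _ [n _ <-].
have gE z : ~ (\bigcup_n N n) z -> projT1 (cid2 (rep n)) z = f_ n z.
  by move=> Nz; apply: contrapT => gz; apply: Nz; exists n.
rewrite -(gE x Nx) -(gE y Ny); case: cid2 => g /= _ gd.
by apply: le_trans (gd x y); rewrite lee_fin ler_norm.
Qed.

End intrinsic_distance.

(** * Maximal functions *)

Section maximal_function.
Context (R : realType) (X : ptopologicalType).
Context (m : {sigma_finite_measure set (borel X) -> \bar R}).
Context (E : dirichlet_form m) (mu : set (borel X) -> \bar R).
Context (S : set (set X)).

Lemma negligible_borel (N : set X) : m.-negligible (N : set (borel X)) ->
  exists M : set X, [/\ measurable (M : set (borel X)),
    m.-negligible (M : set (borel X)) & N `<=` M].
Proof.
by move=> [M [mM M0 NM]]; exists M; split => //; exact/negligibleP.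
Qed.

Lemma competitor_ae (A B : set X) r : m.-negligible (A `+` B : set (borel X)) ->
  competitor E mu A r = competitor E mu B r.
Proof.
have sub (C D : set X) : m.-negligible (C `+` D : set (borel X)) ->
    competitor E mu C r `<=` competitor E mu D r.
  move=> CD f [fL f0 fr]; split => //.
  apply: negligibleS (negligibleU f0 CD) => x /= /not_implyP[Dx fx].
  have [Cx|nCx] := pselect (C x); first by left => /(_ Cx).
  by right; right.
move=> AB; apply/seteqP.
by split; apply: sub; [exact: AB|rewrite setYC; exact: AB].
Qed.

Lemma maximal_function_ae (A B : set X) :
  m.-negligible (A `+` B : set (borel X)) ->
  maximal_function E S mu A = maximal_function E S mu B.
Proof.
move=> AB; congr (xget _ _); apply/funext => g; apply/propext.
by split => -[g0 mg gmax]; split => // r r0; have := gmax r r0;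
  rewrite /= (competitor_ae r AB).
Qed.

Lemma is_maximal_function_uniq A (f g : X -> \bar R) :
  is_maximal_function E S mu A f -> is_maximal_function E S mu A g ->
  f = g %[ae m].
Proof.
move=> [f0 _ fmax] [g0 _ gmax].
have tfg n : \forall x \ae m, trunc n.+1%:R f x = trunc n.+1%:R g x.
  have n0 : 0 < n.+1%:R :> R by [].
  have [fC fM] := fmax _ n0; have [gC gM] := gmax _ n0.
  apply: filterS2 (gM _ fC) (fM _ gC) => x fgx gfx.
  by apply/eqP; rewrite eq_le; apply/andP; split.
have /ae_foralln {}tfg := tfg.
apply: filterS tfg => x fgx _.
have le (u v : X -> \bar R) :
    (forall x, 0 <= u x)%E -> (forall x, 0 <= v x)%E ->
    (forall n, trunc n.+1%:R u x = trunc n.+1%:R v x) -> (u x <= v x)%E.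
  move=> u0 v0 uv; rewrite leNgt; apply/negP => vu.
  have vfin : v x \is a fin_num.
    by rewrite ge0_fin_numE// (lt_le_trans vu)// leey.
  have [n vn] : exists n, (v x < n.+1%:R%:E)%E.
    exists (Num.truncn (fine (v x))); rewrite -{1}(fineK vfin) lte_fin.
    exact: truncnS_gt.
  have : (trunc n.+1%:R u x)%:E = (trunc n.+1%:R v x)%:E by rewrite uv.
  rewrite !EFin_trunc// [RHS]min_l ?ltW//.
  by apply/eqP; rewrite gt_eqF// lt_min vu.
by apply/eqP; rewrite eq_le !le// => n; rewrite fgx.
Qed.

Lemma maximal_functionE A (g : X -> \bar R) :
  is_maximal_function E S mu A g -> maximal_function E S mu A = g %[ae m].
Proof.
move=> gmax; apply: is_maximal_function_uniq (gmax).
by apply: (@xgetPex _ _ [set h | is_maximal_function E S mu A h]); exists g.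
Qed.

Lemma borel_measurable_sub d (T : measurableType d) (g : X -> T) :
  (measurable : set (set (borel X))) `<=` S ->
  measurable_fun setT (g : borel X -> T) ->
  measurable_fun [set: g_sigma_algebraType S] (g : g_sigma_algebraType S -> T).
Proof.
by move=> bS mg _ Y mY; apply: sub_sigma_algebra; apply: bS; exact: mg.
Qed.

(** A null set [M], which may be required to contain a given one, such that the
distance to the complement of [M] in [A] dominates all competitors for [A], at
all levels [r]. *)
Lemma competitors_le_dist_to (d : X -> X -> \bar R) (A N : set X) :
  sobolev_to_lipschitz E (completed_algebra_gen m) d mu ->
  m.-negligible (N : set (borel X)) ->
  exists M : set X, [/\ measurable (M : set (borel X)),
    m.-negligible (M : set (borel X)), N `<=` M &
    forall f r, competitor E mu A r f ->
      \forall x \ae m, ((f x)%:E <= dist_to d (A `\` M) x)%E].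
Proof.
move=> [_ SL] N0.
(* all measurable versions of competitors, at all levels *)
pose H := [set h : borel X -> \bar R | measurable_fun setT h /\
  exists f r, competitor E mu A r f /\ h = EFin \o f %[ae m]].
have toH f r : competitor E mu A r f -> exists2 h, H h & h = EFin \o f %[ae m].
  move=> fC; have [fL _ _] := fC; have [g gf [mg _]] := SL f fL.
  have [h mh gh] :=
    @ae_measurable_version _ _ _ m _ ((measurable_EFinP _ _).2 mg).
  have hf : h = EFin \o f %[ae m].
    by apply: filterS2 gf gh => x gfx ghx xT; rewrite -(ghx xT) /= (gfx xT).
  by exists h => //; split => //; exists f, r.
have [H0|H0] := pselect (H !=set0); last first.
  have [M [mM M0 NM]] := negligible_borel N0.
  exists M; split => // f r /toH[h Hh _]; exfalso; apply: H0.
  by exists h.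
have [h_ Hh_ h_sup] := ess_sup_family m H0 (fun h Hh => proj1 Hh).
have rep n : exists g : X -> R, [/\ h_ n = EFin \o g %[ae m],
    g = cst 0 %[ae m in A] & forall x y, (`|g x - g y|%:E <= d x y)%E].
  have [_ [f [r [[fL f0 _] hf]]]] := Hh_ n; have [g gf [_ gd]] := SL f fL.
  exists g; split => //.
    by apply: filterS2 gf hf => x /(_ I)/= -> /(_ I).
  by apply: filterS2 gf f0 => x /(_ I)/= ->.
have {rep}[g_ g_P] := choice rep.
pose Z n := A `&` [set x | g_ n x <> 0].
have Z0 n : m.-negligible (Z n : set (borel X)).
  have [_ g0 _] := g_P n.
  by apply: negligibleS g0 => x [Ax gx] /= /(_ Ax).
have [M [mM M0 NM]] := negligible_borel (negligibleU N0 (negligible_bigcup Z0)).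
exists M; split => //; first by move=> x Nx; apply: NM; left.
move=> f r /toH[h Hh hf].
have hg : \forall x \ae m, forall n, h_ n x = (g_ n x)%:E.
  apply/ae_foralln => n; have [hg _ _] := g_P n.
  by apply: filterS hg => x /(_ I).
apply: filterS3 (h_sup h Hh) hf hg => x hx /(_ I)/= <- hgx.
apply: le_trans hx _; apply: ge_ereal_sup => _ [n _ <-].
rewrite hgx; have [_ _ gd] := g_P n.
apply: Lip_le_dist_to => // y [Ay My]; apply: contrapT => gy; apply: My.
by apply: NM; right; exists n.
Qed.

(** If the distance to [B] dominates all competitors for [B], then its
version [g] is a maximal function: the truncations of the distance are
themselves competitors, by the Rademacher property. *)
Lemma is_maximal_function_dist_to (d : X -> X -> \bar R) (B : set X)
    (g : X -> \bar R) :
  ext_pseudo_distance d -> rademacher E (completed_algebra_gen m) d mu ->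
  measurable_fun [set: g_sigma_algebraType (completed_algebra_gen m)]
    (dist_to d B : g_sigma_algebraType (completed_algebra_gen m) -> \bar R) ->
  (forall f r, competitor E mu B r f ->
      \forall x \ae m, ((f x)%:E <= dist_to d B x)%E) ->
  (forall x, 0 <= g x)%E ->
  measurable_fun [set: g_sigma_algebraType S]
    (g : g_sigma_algebraType S -> \bar R) ->
  dist_to d B = g %[ae m] ->
  is_maximal_function E S mu B g.
Proof.
move=> dd Rad mdB leB g0 mg dg; split => // r r0 /=; rewrite -/(trunc r g).
have rge0 := ltW r0.
have d0 x : (0 <= dist_to d B x)%E by exact: dist_to_ge0.
have tdg : trunc r (dist_to d B) = trunc r g %[ae m].
  by apply: filterS dg => x /(_ I); rewrite /trunc => ->.
split.
  split.
  - apply: (Lloc_ae tdg); apply: (Lip1_bounded_Lloc (r := r) Rad).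
      split; first exact: measurable_trunc.
      by apply: trunc_lipschitz => // x y; exact: dist_to_triangle.
    by move=> x; exact: normr_trunc_le.
  - apply: filterS tdg => x /(_ I) <- Bx; apply: EFin_inj.
    by rewrite EFin_trunc// dist_to_in// min_l// lee_fin.
  - by apply: aeW => x; exact: normr_trunc_le.
move=> f fC; have [_ _ fr] := fC.
apply: filterS3 (leB f r fC) fr dg => x fd fxr /(_ I) dgx.
rewrite -[fine _]/(trunc r g x) -lee_fin EFin_trunc// le_min -dgx fd lee_fin.
exact: le_trans (ler_norm _) fxr.
Qed.

End maximal_function.

Theorem theorem4p23 (R : realType) (X : ptopologicalType)
  (m : {sigma_finite_measure set (borel X) -> \bar R})
  (Sigma : set (set X))
  (E : dirichlet_form m)
  (d : X -> X -> \bar R)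
  (mu : {sigma_finite_measure set (borel X) -> \bar R})
  (X_luzin : @luzin_space R X)
  (m_full : full_support m)
  (Sigma_algebra : sigma_algebra setT Sigma)
  (borel_Sigma : (measurable : set (set (borel X))) `<=` Sigma)
  (Sigma_completed : Sigma `<=` completed_algebra_gen m)
  (E_qr : quasi_regular E)
  (E_sl : strongly_local E)
  (d_dist : ext_pseudo_distance d)
  (mu_polar : not_charging_polar E mu)
  (mu_moderate : moderate E mu)
  (Rad : rademacher E (completed_algebra_gen m) d mu)
  (SL : sobolev_to_lipschitz E (completed_algebra_gen m) d mu)
  (d_meas : forall A, Sigma A ->
    measurable_fun [set: g_sigma_algebraType (completed_algebra_gen m)]
      (dist_to d A : g_sigma_algebraType (completed_algebra_gen m) -> \bar R))
  (d_adm : admissible d) :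
  forall A, Sigma A ->
  exists At : set X,
    [/\ Sigma At, At `<=` A, m.-negligible (A `+` At) &
      [/\ maximal_function E Sigma mu A
            = maximal_function E Sigma mu At %[ae m],
          maximal_function E Sigma mu At = dist_to d At %[ae m] &
          dist_to d At = dist_to (intrinsic_dist E mu) At %[ae m]]].
Proof.
move=> A SA.
have [N N0 dmu_le] := intrinsic_dist_le_ae X_luzin d_dist SL.
have dmu_ge := intrinsic_dist_ge d_dist Rad d_adm.
have [M [mM M0 NM fd]] := competitors_le_dist_to A SL N0.
have SAt : Sigma (A `\` M).
  have mS B : Sigma B -> measurable (B : set (g_sigma_algebraType Sigma)).
    exact: sub_sigma_algebra.
  have : measurable (A `\` M : set (g_sigma_algebraType Sigma)).
    by apply: measurableD; apply: mS => //; exact: borel_Sigma.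
  by rewrite [measurable](sigma_algebra_id Sigma_algebra).
have AAt : m.-negligible (A `+` (A `\` M) : set (borel X)).
  apply: negligibleS M0 => x [[Ax]|[[Ax _]]] //= h.
  by apply: contrapT => Mx; apply: h.
have [g0 mg0 dg0] := ae_measurable_version (d_meas _ SAt).
(* a maximal function is nonnegative at every point, [g0] only almost
   everywhere *)
pose g x := maxe (g0 x) 0%E.
have gd : dist_to d (A `\` M) = g %[ae m].
  apply: filterS dg0 => x /(_ I) h _; rewrite /g -h.
  by rewrite max_l//; exact: dist_to_ge0.
have gmax : is_maximal_function E Sigma mu (A `\` M) g.
  apply: (is_maximal_function_dist_to d_dist Rad (d_meas _ SAt)) => //.
  - by move=> f r; rewrite -(competitor_ae _ _ _ AAt); exact: fd.
  - by move=> x; rewrite /g le_max lexx orbT.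
  - apply: borel_measurable_sub => //; exact: measurable_maxe.
exists (A `\` M); split => //; split.
- by rewrite (maximal_function_ae _ _ _ AAt); exact: aeW.
- by apply: filterS2 (maximal_functionE gmax) gd => x /(_ I) -> /(_ I) ->.
- apply: negligibleS M0 => x /= /not_implyP[_ h]; apply: contrapT => Mx.
  apply: h; have Nx : ~ N x by move=> /NM.
  congr ereal_inf; apply/seteqP; split => _ [y [Ay My] <-]; exists y => //;
    by apply/eqP; rewrite eq_le dmu_ge dmu_le// => /NM.
Qed.
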